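(* Let $\mathbf{X}=(X_\lambda,p_{\lambda\lambda'},\Lambda)$ and $\mathbf{Y}=(Y_\mu,q_{\mu\mu'},M)$ be inverse systems in a category $\mathcal{C}$ and let $(f_\mu,\phi),(f'_\mu,\phi'):\mathbf{X}\rightarrow\mathbf{Y}$ be two equivalent morphisms of inverse systems, $(f_\mu,\phi)\sim(f'_\mu,\phi')$. If the morphism $(f_\mu,\phi)$ is co-movable (respectively strongly co-movable), then the morphism $(f'_\mu,\phi')$ is also co-movable (respectively strongly co-movable).
   Context: An inverse system $\mathbf{X}=(X_\lambda,p_{\lambda\lambda'},\Lambda)$ in a category $\mathcal{C}$ consists of a directed preordered set $\Lambda$, objects $X_\lambda$, and morphisms $p_{\lambda\lambda'}:X_{\lambda'}\to X_\lambda$ for $\lambda\le\lambda'$ with $p_{\lambda\lambda}=1$ and $p_{\lambda\lambda'}\circ p_{\lambda'\lambda''}=p_{\lambda\lambda''}$. All index sets are assumed to be cofinite directed sets (each element has only finitely many predecessors). A morphism of inverse systems $(f_\mu,\phi):\mathbf{X}\to\mathbf{Y}$ consists of a function $\phi:M\to\Lambda$ and morphisms $f_\mu:X_{\phi(\mu)}\to Y_\mu$ such that whenever $\mu\le\mu'$ there is $\lambda\ge\phi(\mu),\phi(\mu')$ with $f_\mu\circ p_{\phi(\mu)\lambda}=q_{\mu\mu'}\circ f_{\mu'}\circ p_{\phi(\mu')\lambda}$. For $\lambda\ge\phi(\mu)$ write $f_{\mu\lambda}:=f_\mu\circ p_{\phi(\mu)\lambda}$. Equivalence: $(f_\mu,\phi)\sim(f'_\mu,\phi')$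 if for every $\mu\in M$ there is $\lambda\ge\phi(\mu),\phi'(\mu)$ with $f_\mu\circ p_{\phi(\mu)\lambda}=f'_\mu\circ p_{\phi'(\mu)\lambda}$. $(f_\mu,\phi)$ is co-movable if every $\mu\in M$ admits $\lambda\in\Lambda$, $\lambda\ge\phi(\mu)$, such that each $\lambda'\ge\phi(\mu)$ admits a morphism $r:X_\lambda\to X_{\lambda'}$ of $\mathcal{C}$ with $f_{\mu\lambda}=f_{\mu\lambda'}\circ r$; it is strongly co-movable if in addition $r$ can be chosen so that there is $\lambda^\ast\ge\lambda,\lambda'$ with $r\circ p_{\lambda\lambda^\ast}=p_{\lambda'\lambda^\ast}$. *)

(* Defs.v *)
From Stdlib Require Export RelationClasses List.

Set Implicit Arguments.
Unset Strict Implicit.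

Record Category := {
  obj :> Type;
  hom : obj -> obj -> Type;
  idm : forall A : obj, hom A A;
  comp : forall A B C : obj, hom B C -> hom A B -> hom A C;
  comp_id_l : forall (A B : obj) (f : hom A B), comp (idm B) f = f;
  comp_id_r : forall (A B : obj) (f : hom A B), comp f (idm A) = f;
  comp_assoc : forall (A B C D : obj) (f : hom C D) (g : hom B C) (h : hom A B),
    comp f (comp g h) = comp (comp f g) h
}.
Arguments hom {c} A B.
Arguments idm {c} A.

Declare Scope cat_scope.
Delimit Scope cat_scope with cat.
Open Scope cat_scope.

Notation "g \o f" := (comp g f) (at level 50, left associativity) : cat_scope.

(* Antisymmetry is not required.  Since [le] is reflexive, [cofinite] counts
   [a] among its own predecessors, which does not affect finiteness. *)
Record CofiniteDirectedSet := {
  index :> Type;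
  le : index -> index -> Prop;
  le_preorder : PreOrder le;
  directed : forall a b : index, exists c : index, le a c /\ le b c;
  cofinite : forall a : index, exists s : list index,
    forall b : index, le b a -> In b s
}.

Notation "a <= b" := (le a b) : cat_scope.

(* [bond H : X_b -> X_a] for [H : a <= b].  The two laws quantify over all
   proofs of the comparisons involved, which forces [bond H] not to depend on
   the proof [H]. *)
Record InverseSystem (C : Category) (L : CofiniteDirectedSet) := {
  term :> L -> C;
  bond : forall a b : L, a <= b -> hom (term b) (term a);
  bond_id : forall (a : L) (H : a <= a), bond H = idm (term a);
  bond_comp : forall (a b c : L) (Hab : a <= b) (Hbc : b <= c) (Hac : a <= c),
    bond Hab \o bond Hbc = bond Hac
}.
Arguments bond {C L} i {a b} _.

Record SystemMorphism (C : Category) (L M : CofiniteDirectedSet)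
    (X : InverseSystem C L) (Y : InverseSystem C M) := {
  phi : M -> L;
  mor : forall m : M, hom (X (phi m)) (Y m);
  mor_compat : forall (m m' : M) (Hm : m <= m'),
    exists (l : L) (H : phi m <= l) (H' : phi m' <= l),
      mor m \o bond X H = bond Y Hm \o mor m' \o bond X H'
}.

Section Morphisms.

Variables (C : Category) (L M : CofiniteDirectedSet).
Variables (X : InverseSystem C L) (Y : InverseSystem C M).

(* The morphism written f_{mu lambda}. *)
Definition mor_at (f : SystemMorphism X Y) (m : M) (l : L)
    (H : phi f m <= l) : hom (X l) (Y m) :=
  mor f m \o bond X H.

Definition equivalent (f f' : SystemMorphism X Y) : Prop :=
  forall m : M, exists (l : L) (H : phi f m <= l) (H' : phi f' m <= l),
    mor_at H = mor_at H'.

Definition co_movable (f : SystemMorphism X Y) : Prop :=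
  forall m : M, exists (l : L) (H : phi f m <= l),
    forall (l' : L) (H' : phi f m <= l'), exists r : hom (X l) (X l'),
      mor_at H = mor_at H' \o r.

Definition strongly_co_movable (f : SystemMorphism X Y) : Prop :=
  forall m : M, exists (l : L) (H : phi f m <= l),
    forall (l' : L) (H' : phi f m <= l'), exists r : hom (X l) (X l'),
      mor_at H = mor_at H' \o r /\
      exists (ls : L) (Hl : l <= ls) (Hl' : l' <= ls),
        r \o bond X Hl = bond X Hl'.

End Morphisms.

(* Main.v *)
Require Import Defs.

Set Implicit Arguments.
Unset Strict Implicit.

(** Equivalent morphisms [f] and [f'] agree at some stage [l0] for a given
    [m], hence at every later stage.  So a factorization of [f_l] through
    [f_l''] becomes one of [f'] as soon as it is precomposed with a bond from
    a stage [l1] past both [l] and [l0], and [l''] is itself past [l0].  Given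
    a target stage [l'] for [f'], apply co-movability of [f] not at [l']
    (which need not even dominate [phi f m]) but at some [l''] past [l'] and
    [l0], and descend by the bond [X_l'' -> X_l']: the new morphism is
    [bond \o r \o bond : X_l1 -> X_l -> X_l'' -> X_l'].  The choice of [l1]
    uses only [l] and [l0], so it is uniform in [l'].  Composing with bonds on
    both sides also preserves the property of becoming a bond at a later stage,
    which gives the strong version; [mor_at_factor_transfer] and
    [eventually_bond_sandwich] are these two facts. *)

Lemma le_transitive (L : CofiniteDirectedSet) (a b c : L) :
  a <= b -> b <= c -> a <= c.
Proof. exact (@PreOrder_Transitive _ _ (@le_preorder L) a b c). Qed.

Section Transfer.

Variables (C : Category) (L M : CofiniteDirectedSet).
Variables (X : InverseSystem C L) (Y : InverseSystem C M).

Lemma mor_at_bond (f : SystemMorphism X Y) (m : M) (a b : L)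
    (Ha : phi f m <= a) (Hab : a <= b) (Hb : phi f m <= b) :
  mor_at Ha \o bond X Hab = mor_at Hb.
Proof.
unfold mor_at.
now rewrite <- comp_assoc, (bond_comp X Ha Hab Hb).
Qed.

Lemma mor_at_eq_later (f f' : SystemMorphism X Y) (m : M) (a b : L)
    (Ha : phi f m <= a) (Ha' : phi f' m <= a)
    (Hb : phi f m <= b) (Hb' : phi f' m <= b) :
  mor_at Ha = mor_at Ha' -> a <= b -> mor_at Hb = mor_at Hb'.
Proof.
intros E Hab.
now rewrite <- (mor_at_bond Ha Hab Hb), <- (mor_at_bond Ha' Hab Hb'), E.
Qed.

(** The two bonds move the ends of the factorization to [l1] and [l'']; since
    [f] and [f'] agree at both of these stages, the relation satisfied by [r]
    can be read for [f'], and there it descends to [l']. *)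
Lemma mor_at_factor_transfer (f f' : SystemMorphism X Y) (m : M)
    (l l1 l' l'' : L) (r : hom (X l) (X l''))
    (Hl : phi f m <= l) (Hl'' : phi f m <= l'') (Hl1 : phi f m <= l1)
    (Kl1 : phi f' m <= l1) (Kl' : phi f' m <= l') (Kl'' : phi f' m <= l'')
    (J : l <= l1) (J' : l' <= l'') :
  mor_at Hl1 = mor_at Kl1 -> mor_at Hl'' = mor_at Kl'' ->
  mor_at Hl = mor_at Hl'' \o r ->
  mor_at Kl1 = mor_at Kl' \o (bond X J' \o r \o bond X J).
Proof.
intros E1 E'' Er.
rewrite !comp_assoc, (mor_at_bond Kl' J' Kl''), <- E'', <- Er.
now rewrite (mor_at_bond Hl J Hl1).
Qed.

Lemma eventually_bond_sandwich (l l1 l' l'' : L) (r : hom (X l) (X l''))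
    (J : l <= l1) (J' : l' <= l'') :
  (exists (ls : L) (Hl : l <= ls) (Hl'' : l'' <= ls),
    r \o bond X Hl = bond X Hl'') ->
  exists (ls : L) (H1 : l1 <= ls) (H' : l' <= ls),
    (bond X J' \o r \o bond X J) \o bond X H1 = bond X H'.
Proof.
intros (ls & Hl & Hl'' & E).
destruct (directed ls l1) as (t & Hls & H1).
pose proof (le_transitive Hl'' Hls) as Ht.
exists t, H1, (le_transitive J' Ht).
(* Both [l <= l1 <= t] and [l <= ls <= t] give the bond of [l <= t]. *)
rewrite <- comp_assoc, (bond_comp X J H1 (le_transitive Hl Hls)).
rewrite <- (bond_comp X Hl Hls (le_transitive Hl Hls)).
rewrite <- comp_assoc, (comp_assoc r), E.
now rewrite (bond_comp X Hl'' Hls Ht), (bond_comp X J' Ht (le_transitive J' Ht)).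
Qed.

(** The part of the argument common to both notions.  The property [P] of the
    morphisms between stages is whatever is demanded of [r] besides the
    factorization; stability under composition with bonds is what the transfer
    requires of it. *)
Lemma factor_property_transfer (P : forall a b : L, hom (X a) (X b) -> Prop)
    (P_sandwich : forall (l l1 l' l'' : L) (r : hom (X l) (X l''))
      (J : l <= l1) (J' : l' <= l''),
      P l l'' r -> P l1 l' (bond X J' \o r \o bond X J))
    (f f' : SystemMorphism X Y) (Hff' : equivalent f f') :
  (forall m : M, exists (l : L) (H : phi f m <= l),
    forall (l' : L) (H' : phi f m <= l'), exists r : hom (X l) (X l'),
      mor_at H = mor_at H' \o r /\ P l l' r) ->
  forall m : M, exists (l : L) (H : phi f' m <= l),
    forall (l' : L) (H' : phi f' m <= l'), exists r : hom (X l) (X l'),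
      mor_at H = mor_at H' \o r /\ P l l' r.
Proof.
intros Hf m.
destruct (Hf m) as (l & Hl & Hr).
destruct (Hff' m) as (l0 & H0 & K0 & E0).
destruct (directed l l0) as (l1 & J & J0).
exists l1, (le_transitive K0 J0); intros l' Kl'.
destruct (directed l' l0) as (l'' & J' & J0').
destruct (Hr l'' (le_transitive H0 J0')) as (r & Er & Pr).
exists (bond X J' \o r \o bond X J); split; [|now apply P_sandwich].
apply (@mor_at_factor_transfer f f' m l l1 l' l'' r Hl (le_transitive H0 J0')
  (le_transitive H0 J0) _ Kl' (le_transitive K0 J0') J J').
- exact (mor_at_eq_later _ _ E0 J0).
- exact (mor_at_eq_later _ _ E0 J0').
- exact Er.
Qed.

End Transfer.

Theorem proposition5p10 (C : Category) (L M : CofiniteDirectedSet)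
    (X : InverseSystem C L) (Y : InverseSystem C M)
    (f f' : SystemMorphism X Y) (Hff' : equivalent f f') :
  (co_movable f -> co_movable f') /\
  (strongly_co_movable f -> strongly_co_movable f').
Proof.
split; intros Hf.
- intros m.
  destruct (@factor_property_transfer C L M X Y (fun _ _ _ => True)
    (fun _ _ _ _ _ _ _ _ => I) f f' Hff') with (m := m) as (l & H & Hr).
  + intros n; destruct (Hf n) as (l & H & Hr).
    exists l, H; intros l' H'; destruct (Hr l' H') as (r & Er).
    now exists r.
  + exists l, H; intros l' H'; destruct (Hr l' H') as (r & Er & _).
    now exists r.
- exact (@factor_property_transfer C L M X Y
    (fun a b r => exists (ls : L) (Ha : a <= ls) (Hb : b <= ls),
      r \o bond X Ha = bond X Hb)
    (@eventually_bond_sandwich C L X) f f' Hff' Hf).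
Qed.
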